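(* Let $G$ be a bipartite poset on $n$ vertices (top elements and bottom elements, every edge directed from a bottom element to a top element), and let $M$ be the number of pairs $(S_t,S_b)$ of a subset $S_t$ of top elements and a subset $S_b$ of bottom elements such that there exists a perfect matching in $G$ between $S_t$ and $S_b$. Then one can test, with success probability $2/3$, whether a distribution $p$ over the vertices of $G$ is monotone or $\epsilon$-far from any monotone distribution using $O((\log M)/\epsilon^2)$ i.i.d. samples from $p$; in particular $O(n/\epsilon^2)$ samples suffice for every such $G$.
   Context: A distribution $p$ is monotone with respect to $G$ if $p(u)\le p(v)$ for every edge $(u,v)$ of $G$, and $\epsilon$-far from monotone if its total variation distance to every monotone distribution on the vertex set is at least $\epsilon$. *)

(* Defs.v *)
From HB Require Import structures.
From mathcomp Require Import all_boot all_order all_algebra.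
From mathcomp Require Import reals exp.

Set Implicit Arguments.
Unset Strict Implicit.
Unset Printing Implicit Defensive.

Import Order.TTheory GRing.Theory Num.Theory.
Local Open Scope ring_scope.

(* The elements outside [top] are the bottom elements; an isolated vertex may
   be on either side. *)
Record bipartite_poset := BipartitePoset {
  vertex : finType;
  top : {set vertex};
  edge : rel vertex;
  edge_bot_top : forall u v, edge u v -> (u \in ~: top) && (v \in top)
}.

(* [edge] is the strict order of the poset: no axiom beyond [edge_bot_top] is
   needed, since no vertex is both the head and the tail of an edge. *)
Lemma edge_irr (G : bipartite_poset) : irreflexive (@edge G).
Proof.
move=> u; apply/negP => /edge_bot_top.
by rewrite inE => /andP[/negP].
Qed.

Lemma edge_trans (G : bipartite_poset) : transitive (@edge G).
Proof.
move=> v u w /edge_bot_top/andP[_ tv] /edge_bot_top/andP[].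
by rewrite inE tv.
Qed.

Section Matchings.
Variable G : bipartite_poset.

(* A set of edges (bottom, top) between the two sets that covers every vertex
   of either set exactly once. *)
Definition perfect_matching (St Sb : {set vertex G})
    (N : {set vertex G * vertex G}) : bool :=
  [&& [forall x in N, [&& x.1 \in Sb, x.2 \in St & edge x.1 x.2]],
      [forall u in Sb, #|[set x in N | x.1 == u]| == 1%N]
    & [forall v in St, #|[set x in N | x.2 == v]| == 1%N]].

Definition matched_pairs : {set {set vertex G} * {set vertex G}} :=
  [set S : {set vertex G} * {set vertex G} |
    [&& S.1 \subset top G, S.2 \subset ~: top G
      & [exists N, perfect_matching S.1 S.2 N]]].

End Matchings.

Section Testing.
Variables (R : realType) (G : bipartite_poset).
Implicit Types p q : {ffun vertex G -> R}.

Definition distribution p : Prop :=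
  (forall x, 0 <= p x) /\ \sum_x p x = 1.

Definition monotone p : Prop := forall u v, edge u v -> p u <= p v.

Definition tv_dist p q : R := 2^-1 * \sum_x `|p x - q x|.

Definition far_from_monotone (eps : R) p : Prop :=
  forall q, distribution q -> monotone q -> eps <= tv_dist p q.

(* The law of m i.i.d. samples from p. *)
Definition sample_pr p (m : nat) (s : {ffun 'I_m -> vertex G}) : R :=
  \prod_(i < m) p (s i).

(* A possibly randomized test on m samples is given by A s, its probability of
   accepting when the samples are s. *)
Definition accept_pr p (m : nat) (A : {ffun 'I_m -> vertex G} -> R) : R :=
  \sum_s sample_pr p s * A s.

Definition reject_pr p (m : nat) (A : {ffun 'I_m -> vertex G} -> R) : R :=
  \sum_s sample_pr p s * (1 - A s).

Definition monotonicity_tester (eps : R) (m : nat)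
    (A : {ffun 'I_m -> vertex G} -> R) : Prop :=
  [/\ forall s, 0 <= A s <= 1,
      forall p, distribution p -> monotone p -> 2 / 3 <= accept_pr p A
    & forall p, distribution p -> far_from_monotone eps p ->
        2 / 3 <= reject_pr p A].

End Testing.

Definition testable_with (R : realType) (G : bipartite_poset) (eps : R)
    (m : nat) : Prop :=
  exists A : {ffun 'I_m -> vertex G} -> R, monotonicity_tester eps A.

(* Main.v *)
(** A perfect matching between [S_b] and [S_t] forces [p(S_b) <= p(S_t)] for
    monotone [p].  Conversely, match greedily along edges of largest violation
    [p u - p v], and give both endpoints of a matched edge the weight of that
    edge: every edge of the graph is then dominated by the weight at one of its
    endpoints, so lowering the bottom elements and raising the top elements by
    these weights makes [p] monotone.  After normalization this shows that the
    distance to monotonicity is at most twice the discrepancy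
    [p(S_b) - p(S_t)] of the greedy matching.  The tester rejects when the
    empirical discrepancy of some matched pair exceeds [eps / 4]; a Chernoff
    bound and a union bound over the [M] matched pairs control its error.
    The greedy choice loses a factor 2 against linear programming duality,
    which only affects the constant. *)

Require Import Defs.
From HB Require Import structures.
From mathcomp Require Import all_boot all_order all_algebra.
From mathcomp Require Import reals sequences exp.
From mathcomp Require Import ring lra.

Import Order.TTheory GRing.Theory Num.Theory.
Local Open Scope ring_scope.

(** * Perfect matchings and sums over their endpoints *)

Section PerfectMatchings.
Variable G : bipartite_poset.
Implicit Types (St Sb : {set vertex G}) (N : {set vertex G * vertex G}).

Lemma perfect_matchingP St Sb N :
  reflect [/\ forall x, x \in N -> [/\ x.1 \in Sb, x.2 \in St & edge x.1 x.2],
              forall u, u \in Sb -> #|[set x in N | x.1 == u]| = 1%N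
            & forall v, v \in St -> #|[set x in N | x.2 == v]| = 1%N]
          (perfect_matching St Sb N).
Proof.
apply: (iffP and3P) => -[].
  move=> /forall_inP NE /forall_inP N1 /forall_inP N2; split.
  - by move=> x /NE /and3P.
  - by move=> u /N1 /eqP.
  - by move=> v /N2 /eqP.
move=> NE N1 N2; split; apply/forall_inP.
- by move=> x /NE /and3P.
- by move=> u /N1 /eqP.
- by move=> v /N2 /eqP.
Qed.

Lemma perfect_matching0 : perfect_matching set0 set0 (set0 : {set vertex G * vertex G}).
Proof. by apply/perfect_matchingP; split=> x; rewrite inE. Qed.

(** The new element opens a fresh fiber and leaves the old ones unchanged. Applied to both
    projections, this lets a matching grow by a disjoint edge. *)
Lemma card_fiberU1 {T : finType} {K : eqType} (f : T -> K) (A : {set T})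
    (B : pred K) (a : T) :
    (forall x, x \in A -> B (f x)) -> ~~ B (f a) ->
    (forall b, B b -> #|[set x in A | f x == b]| = 1%N) ->
  forall b, (b == f a) || B b -> #|[set x in a |: A | f x == b]| = 1%N.
Proof.
move=> AB Ba A1 b; have [->{b} _|bNa /= Bb] := eqVneq b (f a).
  rewrite -(cards1 a); apply: eq_card => x; rewrite !inE.
  have [->|_] /= := eqVneq x a; first by rewrite eqxx.
  by apply/negP => /andP[/AB Bx /eqP fx]; rewrite -fx Bx in Ba.
rewrite -(A1 b Bb); apply: eq_card => x; rewrite !inE.
have [->|//] /= := eqVneq x a.
rewrite eq_sym (negPf bNa); apply/esym/negP => /andP[/AB].
by rewrite (negPf Ba).
Qed.

Lemma perfect_matchingU1 St Sb N u v :
    edge u v -> u \notin Sb -> v \notin St -> perfect_matching St Sb N ->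
  perfect_matching (v |: St) (u |: Sb) ((u, v) |: N).
Proof.
move=> uv uSb vSt /perfect_matchingP[NE N1 N2]; apply/perfect_matchingP; split.
- move=> x; rewrite !inE => /orP[/eqP-> /=|/NE[-> -> ->]]; last by rewrite !orbT.
  by rewrite !eqxx.
- move=> w; rewrite !inE; apply: (card_fiberU1 fst N (mem Sb) (u, v)) => //.
  by move=> x /NE[].
- move=> w; rewrite !inE; apply: (card_fiberU1 snd N (mem St) (u, v)) => //.
  by move=> x /NE[].
Qed.

(** [f] restricts to a bijection from [A] onto [B]; for a projection of a matching, this turns a sum
    over matched vertices into a sum over edges. *)
Lemma sum_fiber {R : realType} {T K : finType} (f : T -> K) (A : {set T})
    (B : {set K}) (F : K -> R) :
    (forall x, x \in A -> f x \in B) ->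
    (forall b, b \in B -> #|[set x in A | f x == b]| = 1%N) ->
  \sum_(b in B) F b = \sum_(x in A) F (f x).
Proof.
move=> AB A1; rewrite (partition_big f (mem B)) //=.
apply: eq_bigr => b bB; rewrite (eq_bigr (fun=> F b)); last first.
  by move=> x /andP[_ /eqP->].
by have := A1 b bB; rewrite cardsE sumr_const => ->; rewrite mulr1n.
Qed.

End PerfectMatchings.

(** * Discrepancy of a matched pair and the greedy matching *)

Section Discrepancy.
Variables (R : realType) (G : bipartite_poset).
Implicit Types (p q : {ffun vertex G -> R}) (S : {set vertex G} * {set vertex G}).

(** The contribution of a single sample: [disc] is the mean of this score under [p], and the tester
    sums it over the samples. *)
Definition disc_score S (x : vertex G) : R := (x \in S.2)%:R - (x \in S.1)%:R.

Definition disc p S : R := \sum_x p x * disc_score S x.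

Lemma discE p S : disc p S = \sum_(x in S.2) p x - \sum_(x in S.1) p x.
Proof.
rewrite /disc [X in X - _]big_mkcond [X in _ - X]big_mkcond -sumrB.
apply: eq_bigr => x _; rewrite /disc_score.
by case: (x \in S.2); case: (x \in S.1) => /=; lra.
Qed.

Lemma norm_disc_score S x : `|disc_score S x| <= 1.
Proof.
by rewrite /disc_score; case: (x \in _); case: (x \in _) => /=;
  rewrite ?subrr ?subr0 ?sub0r ?normrN ?normr1 ?normr0.
Qed.

Lemma disc_monotone_le0 p S :
  monotone p -> S \in matched_pairs G -> disc p S <= 0.
Proof.
move=> pmon; rewrite inE => /and3P[_ _ /existsP[N /perfect_matchingP[NE N1 N2]]].
rewrite discE subr_le0.
rewrite (sum_fiber fst N) //; last by move=> x /NE[].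
rewrite (sum_fiber snd N) //; last by move=> x /NE[].
by apply: ler_sum => x /NE[_ _]; apply: pmon.
Qed.

Lemma greedy_matching p (A : {set vertex G}) :
  exists S (alpha : vertex G -> R),
    [/\ S \in matched_pairs G, S.1 \subset A, S.2 \subset A,
        forall x, 0 <= alpha x
      & (forall u v, u \in A -> v \in A -> edge u v ->
           p u - p v <= alpha u + alpha v)
        /\ \sum_x alpha x = 2 * disc p S].
Proof.
have [k] := ubnP #|A|; elim: k A => // k IH A; rewrite ltnS => kA.
pose viol (e : vertex G * vertex G) :=
  [&& e.1 \in A, e.2 \in A, edge e.1 e.2 & p e.2 < p e.1].
case: (pickP viol) => [e0 ve0|noviol]; last first.
  exists (set0, set0), (fun=> 0); split; rewrite ?sub0set //=.
    by rewrite inE !sub0set; apply/existsP; exists set0; apply: perfect_matching0.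
  split; last by rewrite discE /= !big_set0 big1 // subrr mulr0.
  move=> u v uA vA uv; have := noviol (u, v).
  by rewrite /viol /= uA vA uv /= addr0 subr_le0 => /negbT; rewrite -leNgt.
case: (@arg_maxP _ _ _ e0 viol (fun e => p e.1 - p e.2) ve0).
move=> [u0 v0] /and4P[/= u0A v0A uv0 lt0] max0.
have /andP[u0b v0t] := edge_bot_top uv0.
have u0v0 : u0 != v0 by apply: contraTneq uv0 => ->; rewrite edge_irr.
pose A' := A :\ u0 :\ v0.
have kA' : (#|A'| < k)%N.
  apply: leq_trans kA; apply: leq_ltn_trans (subset_leq_card (subD1set _ _)) _.
  by rewrite [X in (_ < X)%N](cardsD1 u0) u0A.
have [[St Sb] [alpha [/= SM StA SbA a0 [acov asum]]]] := IH _ kA'.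
have u0Sb : u0 \notin Sb by apply: contraNN u0v0 => /(subsetP SbA); rewrite !inE eqxx andbF.
have v0St : v0 \notin St by apply: contraNN u0v0 => /(subsetP StA); rewrite !inE eqxx.
pose w0 := p u0 - p v0.
have w0_gt0 : 0 < w0 by rewrite subr_gt0.
pose bump (x : vertex G) : R := w0 * (x == u0)%:R + w0 * (x == v0)%:R.
have bump0 x : 0 <= bump x by rewrite addr_ge0 ?mulr_ge0 ?ler0n ?ltW.
have bump_ge x : ~~ ((x != v0) && (x != u0)) -> w0 <= bump x.
  rewrite negb_and !negbK /bump.
  by case: (x == v0); case: (x == u0) => //= _; move: w0_gt0; lra.
have sA'A : A' \subset A by apply: subset_trans (subD1set _ _) (subD1set _ _).
exists (v0 |: St, u0 |: Sb), (fun x => alpha x + bump x); split=> /=.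
- move: SM; rewrite !inE /= => /and3P[St_top Sb_bot /existsP[N N_pm]].
  rewrite !subUset !sub1set St_top Sb_bot v0t u0b /=.
  by apply/existsP; exists ((u0, v0) |: N); apply: perfect_matchingU1.
- by rewrite subUset sub1set v0A (subset_trans StA).
- by rewrite subUset sub1set u0A (subset_trans SbA).
- by move=> x; rewrite addr_ge0.
split.
  move=> u v uA vA uv; have [vu|uv_le] := ltP (p v) (p u); last first.
    have := a0 u; have := a0 v; have := bump0 u; have := bump0 v.
    by move: uv_le; lra.
  (* Maximality bounds this violation by [w0]. Either both endpoints survive in [A'] and the
     recursive weights suffice, or one of them is [u0] or [v0], where [bump] is at least [w0]. *)
  have := max0 (u, v); rewrite /viol /= uA vA uv vu => /(_ isT) le_w0.
  have [uA'|] := boolP (u \in A'); have [vA'|] := boolP (v \in A').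
  - have := acov _ _ uA' vA' uv; have := bump0 u; have := bump0 v; lra.
  - rewrite !inE vA andbT => vN.
    have := bump_ge _ vN.
    by have := a0 u; have := a0 v; have := bump0 u; move: le_w0; rewrite -/w0; lra.
  - rewrite !inE uA andbT => uN.
    have := bump_ge _ uN.
    by have := a0 u; have := a0 v; have := bump0 v; move: le_w0; rewrite -/w0; lra.
  - move=> _; rewrite !inE uA andbT => uN.
    have := bump_ge _ uN.
    by have := a0 u; have := a0 v; have := bump0 v; move: le_w0; rewrite -/w0; lra.
have sum1 (z : vertex G) : \sum_x w0 * (x == z)%:R = w0.
  rewrite (bigD1 z) //= eqxx mulr1 big1 ?addr0 // => x /negPf->.
  by rewrite mulr0.
rewrite !big_split /= !sum1 asum !discE /= !big_setU1 //= /w0; ring.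
Qed.

(** * From distance to monotonicity to a matched pair of large discrepancy *)

Lemma tv_dist_le1 p q : distribution p -> distribution q -> tv_dist p q <= 1.
Proof.
move=> [p0 p1] [q0 q1]; rewrite /tv_dist.
have: \sum_x `|p x - q x| <= \sum_x (p x + q x).
  apply: ler_sum => x _; rewrite ler_norml.
  by have := p0 x; have := q0 x; move=> ? ?; apply/andP; split; lra.
rewrite big_split /= p1 q1; lra.
Qed.

Lemma uniform_monotone_distribution p : distribution p ->
  exists q, distribution q /\ monotone q.
Proof.
move=> [_ p1]; exists [ffun=> #|vertex G|%:R^-1]; split; last first.
  by move=> u v _; rewrite !ffunE.
split=> [x|]; first by rewrite ffunE invr_ge0.
rewrite (eq_bigr (fun=> #|vertex G|%:R^-1)); last by move=> x _; rewrite ffunE.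
(* The vertex set is nonempty because [p] has total mass 1. *)
rewrite sumr_const -[_ *+ _]mulr_natr mulVf // pnatr_eq0; apply/eqP => V0.
move/eqP: p1; rewrite big_pred0 ?(eq_sym 0) ?oner_eq0 // => x.
by have := fintype0 x V0.
Qed.

Lemma far_le1 eps p : distribution p -> far_from_monotone eps p -> eps <= 1.
Proof.
move=> pd far; have [q [qd qm]] := uniform_monotone_distribution _ pd.
exact: le_trans (far _ qd qm) (tv_dist_le1 _ _ pd qd).
Qed.

Lemma far_disc eps p : distribution p -> far_from_monotone eps p ->
  exists2 S, S \in matched_pairs G & eps / 2 <= disc p S.
Proof.
move=> pd far; have eps1 := far_le1 _ _ pd far; have [p0 p1] := pd.
have [S [alpha [SM _ _ a0 [acov asum]]]] := greedy_matching p setT.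
(* If twice the discrepancy is at least 1, then [eps <= 1] concludes. Otherwise the repaired
   function [r] below has positive mass [Z] and can be normalized. *)
exists S => //; have [W1|W1] := leP 1 (2 * disc p S); first by lra.
(* Truncation at 0 keeps [r] nonnegative; it preserves monotonicity because [r] is nonnegative on
   top elements too. *)
pose r x := if x \in top G then p x + alpha x else Num.max 0 (p x - alpha x).
have r0 x : 0 <= r x.
  by rewrite /r; case: ifP => _; rewrite ?addr_ge0 // le_max lexx.
have rp x : `|p x - r x| <= alpha x.
  have := a0 x; have := p0 x; rewrite ler_norml /r => ? ?; case: ifP => _.
    by apply/andP; split; lra.
  by case: (leP 0 (p x - alpha x)) => ?; apply/andP; split; lra.
have rmon u v : edge u v -> r u <= r v.
  move=> uv; have := edge_bot_top uv; rewrite inE => /andP[/negPf ut vt].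
  rewrite /r ut vt ge_max addr_ge0 //=.
  by have := acov u v (in_setT _) (in_setT _) uv; lra.
have sum_pr : \sum_x `|p x - r x| <= 2 * disc p S.
  by rewrite -asum; apply: ler_sum => x _; apply: rp.
pose Z := \sum_x r x.
have Z1 : `|1 - Z| <= 2 * disc p S.
  by rewrite -[X in X - Z]p1 -sumrB (le_trans (ler_norm_sum _ _ _)).
have Z_gt0 : 0 < Z by move: Z1; rewrite ler_norml => /andP[_]; lra.
have := far [ffun x => r x / Z]; rewrite /tv_dist.
have -> : \sum_x `|p x - [ffun x => r x / Z] x| = \sum_x `|p x - r x / Z|.
  by apply: eq_bigr => x _; rewrite ffunE.
(* Repairing [p] into [r] and normalizing [r] each cost at most [2 * disc p S] in L1 norm. *)
have le_sum : \sum_x `|p x - r x / Z| <= 4 * disc p S.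
  apply: le_trans (_ : \sum_x (`|p x - r x| + r x * (`|1 - Z| / Z)) <= _).
    apply: ler_sum => x _; have -> : p x - r x / Z = (p x - r x) + r x * ((Z - 1) / Z).
      by field; rewrite gt_eqF.
    rewrite (le_trans (ler_normD _ _)) // lerD2l normrM (ger0_norm (r0 x)).
    by rewrite ler_wpM2l // normrM normfV (gtr0_norm Z_gt0) distrC.
  rewrite big_split /= -mulr_suml -/Z mulrCA divff ?gt_eqF // mulr1.
  by move: sum_pr Z1; lra.
move=> farq; have : eps <= 2^-1 * \sum_x `|p x - r x / Z|; last by move: le_sum; lra.
apply: farq.
  split=> [x|]; first by rewrite ffunE divr_ge0 // ltW.
  under eq_bigr do rewrite ffunE.
  by rewrite -mulr_suml divff // gt_eqF.
by move=> u v uv; rewrite !ffunE ler_pM2r ?invr_gt0 // rmon.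
Qed.

End Discrepancy.

(** * A Chernoff bound for bounded scores of i.i.d. samples *)

Section Concentration.
Variables (R : realType) (G : bipartite_poset) (p : {ffun vertex G -> R}).
Hypothesis p_distr : distribution p.

Lemma sample_pr_ge0 m (s : {ffun 'I_m -> vertex G}) : 0 <= sample_pr p s.
Proof. by apply: prodr_ge0 => i _; case: p_distr. Qed.

(** Independence: the mean of a product over the samples is a power of the one-sample mean. *)
Lemma sum_sample_pr_prod m (g : vertex G -> R) :
  \sum_(s : {ffun 'I_m -> vertex G}) sample_pr p s * \prod_i g (s i)
    = (\sum_x p x * g x) ^+ m.
Proof.
transitivity (\sum_(s : {ffun 'I_m -> vertex G}) \prod_i (p (s i) * g (s i))).
  by apply: eq_bigr => s _; rewrite big_split.
by rewrite -(bigA_distr_bigA (fun _ x => p x * g x)) prodr_const card_ord.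
Qed.

Lemma sum_sample_pr m : \sum_(s : {ffun 'I_m -> vertex G}) sample_pr p s = 1.
Proof.
have [_ p1] := p_distr; have := sum_sample_pr_prod m (fun=> 1).
rewrite -mulr_suml p1 mulr1 expr1n => <-.
by apply: eq_bigr => s _; rewrite big1_eq mulr1.
Qed.

Lemma accept_prE m (A : {ffun 'I_m -> vertex G} -> R) :
  accept_pr p A = 1 - reject_pr p A.
Proof.
rewrite -(sum_sample_pr m) /accept_pr /reject_pr -sumrB.
by apply: eq_bigr => s _; ring.
Qed.

(** From [1 - y <= expR (- y)] one gets [expR y <= (1 - y)^-1], and the quadratic dominates this
    inverse as long as [1 - 2 * y] is nonnegative. *)
Lemma expR_le_quadratic (y : R) : `|y| <= 2^-1 -> expR y <= 1 + y + 2 * y ^+ 2.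
Proof.
rewrite ler_norml => /andP[ym yM].
have y1 : 0 < 1 - y by lra.
apply: le_trans (_ : (1 - y)^-1 <= _).
  rewrite -[y]opprK expRN lef_pV2 ?posrE ?expR_gt0 //; last by rewrite opprK; lra.
  by rewrite opprK expR_ge1Dx.
rewrite -(ler_pM2l y1) divff ?gt_eqF // -subr_ge0.
have -> : (1 - y) * (1 + y + 2 * y ^+ 2) - 1 = y ^+ 2 * (1 - 2 * y) by ring.
by rewrite mulr_ge0 ?sqr_ge0 //; lra.
Qed.

Lemma mgf_le (f : vertex G -> R) (c l : R) :
    (forall x, `|f x| <= 1) -> \sum_x p x * f x <= c -> 0 <= l <= 2^-1 ->
  \sum_x p x * expR (l * f x) <= expR (l * c + 2 * l ^+ 2).
Proof.
have [p0 p1] := p_distr; move=> f1 fc /andP[l0 l2].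
apply: le_trans (expR_ge1Dx _).
apply: le_trans (_ : \sum_x p x * (1 + l * f x + 2 * l ^+ 2) <= _).
  apply: ler_sum => x _; apply: ler_wpM2l => //.
  apply: le_trans (expR_le_quadratic _ _) _.
    by rewrite normrM ger0_norm // -[leRHS]mulr1 ler_pM.
  rewrite lerD2l ler_pM2l // exprMn -[leRHS]mulr1 ler_wpM2l ?sqr_ge0 //.
  by rewrite -real_normK ?num_real // expr_le1.
have -> : \sum_x p x * (1 + l * f x + 2 * l ^+ 2) =
          \sum_x p x * (1 + 2 * l ^+ 2) + l * \sum_x p x * f x.
  by rewrite mulr_sumr -big_split /=; apply: eq_bigr => x _; ring.
rewrite -mulr_suml p1 mul1r; have := ler_wpM2l l0 fc; lra.
Qed.

Lemma chernoff m (f : vertex G -> R) (c t : R) :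
    (forall x, `|f x| <= 1) -> \sum_x p x * f x <= c -> 0 <= t <= 2 ->
  \sum_(s : {ffun 'I_m -> vertex G} | m%:R * (c + t) <= \sum_i f (s i))
      sample_pr p s <= expR (- (m%:R * t ^+ 2 / 8)).
Proof.
(* This [l] minimizes the exponent [2 * l ^+ 2 - l * t] per sample, with value [- t ^+ 2 / 8];
   [t <= 2] gives the [l <= 2^-1] required by [mgf_le]. *)
move=> f1 fc /andP[t0 t2]; pose l := t / 4.
have l0 : 0 <= l by rewrite /l; lra.
(* Exponential Markov inequality: the added factor is at least 1 on the event and nonnegative
   elsewhere. *)
apply: le_trans (_ : \sum_(s : {ffun 'I_m -> vertex G}) sample_pr p s *
   \prod_i expR (l * f (s i)) / expR (l * (m%:R * (c + t))) <= _).
  rewrite big_mkcond; apply: ler_sum => s _.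
  rewrite -mulrA -expR_sum -expRB -mulr_sumr -mulrBr.
  case: ifP => [ge_s|_]; last by rewrite mulr_ge0 ?sample_pr_ge0 ?expR_ge0.
  rewrite -[leLHS]mulr1 ler_wpM2l ?sample_pr_ge0 // -[leLHS]expR0 ler_expR.
  by rewrite mulr_ge0 // subr_ge0.
rewrite -mulr_suml (sum_sample_pr_prod _ (fun x => expR (l * f x))).
have mgf : \sum_x p x * expR (l * f x) <= expR (l * c + 2 * l ^+ 2).
  by apply: mgf_le => //; rewrite l0 /l; lra.
rewrite ler_pdivrMr ?expR_gt0 // -expRD.
apply: le_trans (_ : expR (l * c + 2 * l ^+ 2) ^+ m <= _).
  rewrite lerXn2r ?nnegrE ?expR_ge0 //; apply: sumr_ge0 => x _.
  by rewrite mulr_ge0 ?expR_ge0 //; case: p_distr.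
rewrite -expRM_natl ler_expR le_eqVlt; apply/orP; left; apply/eqP.
by rewrite /l; field.
Qed.

End Concentration.

(** * The tester, its error bounds and the count of matched pairs *)

Section Tester.
Variables (R : realType) (G : bipartite_poset).

Lemma testable_with0 (eps : R) :
  (forall p : {ffun vertex G -> R}, distribution p -> ~ far_from_monotone eps p) ->
  testable_with G eps 0.
Proof.
move=> nofar; exists (fun=> 1); split=> [s|p pd _|p pd /(nofar p pd)//].
  by rewrite ler01 lexx.
rewrite accept_prE // /reject_pr big1 => [|s _]; first by lra.
by rewrite subrr mulr0.
Qed.

(** The threshold [eps / 4] lies halfway between the mean 0 allowed for monotone [p] and the mean
    [eps / 2] reached by some pair for far [p]. Both errors thus use deviation [t = eps / 4], and
    [t ^+ 2 / 8 = eps ^+ 2 / 128]. *)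
Lemma testable_with_large_sample (eps : R) (m : nat) :
    0 < eps <= 1 -> (0 < #|matched_pairs G|)%N ->
    #|matched_pairs G|%:R * expR (- (m%:R * eps ^+ 2 / 128)) <= 3^-1 :> R ->
  testable_with G eps m.
Proof.
move=> /andP[eps0 eps1] M0 small; pose e : R := expR (- (m%:R * eps ^+ 2 / 128)).
have eE : e = expR (- (m%:R * (eps / 4) ^+ 2 / 8)).
  by rewrite /e; congr expR; field.
have t02 : 0 <= eps / 4 <= 2 by apply/andP; split; lra.
pose below S (s : {ffun 'I_m -> vertex G}) :=
  \sum_i disc_score R G S (s i) < m%:R * (eps / 4).
pose A s : R := [forall S in matched_pairs G, below S s]%:R.
exists A; split=> [s|p pd pmon|p pd far].
- by rewrite /A; case: [forall _ in _, _]; rewrite ?lexx ?ler01.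
- rewrite accept_prE //; suff: reject_pr p A <= 3^-1 by lra.
  apply: le_trans small; rewrite -/e.
  (* Union bound: a rejected sample is counted at least once on the right, by a pair above the
     threshold. *)
  apply: le_trans (_ : \sum_(S in matched_pairs G)
     \sum_(s | ~~ below S s) sample_pr p s <= _); last first.
    rewrite mulr_natl -sumr_const; apply: ler_sum => S SM; rewrite eE.
    under eq_bigl do rewrite /below -leNgt -[eps / 4]add0r.
    apply: chernoff => //; first exact: norm_disc_score.
    exact: disc_monotone_le0.
  under eq_bigr do rewrite big_mkcond.
  rewrite exchange_big; apply: ler_sum => s _.
  have terms_ge0 S : 0 <= (if ~~ below S s then sample_pr p s else 0).
    by case: ifP => // _; apply: sample_pr_ge0.
  rewrite /A; case: forallP => [_|/forallP].
    by rewrite subrr mulr0; apply: sumr_ge0.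
  rewrite negb_forall => /existsP[S]; rewrite negb_imply => /andP[SM Sabove].
  by rewrite (bigD1 S) //= Sabove subr0 mulr1 lerDl sumr_ge0.
- suff: accept_pr p A <= 3^-1 by rewrite accept_prE //; lra.
  have [S SM epsS] := far_disc _ _ _ _ pd far.
  (* For far [p] the single pair [S] suffices, so one Chernoff term bounds the error; it is at most
     its multiple by the number of pairs. *)
  have e_small : e <= 3^-1.
    apply: le_trans small; rewrite -/e ler_peMl ?expR_ge0 //.
    by rewrite -[1]/(1%:R) ler_nat.
  apply: le_trans e_small; rewrite eE.
  (* The lower tail of the score of [S] is the upper tail of its negation, whose mean is at most
     [- (eps / 2)]. *)
  apply: le_trans (chernoff _ _ _ pd m (fun x => - disc_score R G S x)
    (- (eps / 2)) (eps / 4) _ _ t02).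
  + rewrite [leRHS]big_mkcond; apply: ler_sum => s _.
    rewrite /A sumrN; case: forallP => [/(_ S)|_].
      rewrite SM /below /= => ltS; rewrite mulr1 ifT //.
      have -> : - (eps / 2) + eps / 4 = - (eps / 4) by field.
      by rewrite mulrN lerN2 ltW.
    by rewrite mulr0; case: ifP => // _; apply: sample_pr_ge0.
  + by move=> x; rewrite normrN; apply: norm_disc_score.
  + have -> : \sum_x p x * - disc_score R G S x = - disc R G p S.
      by rewrite /disc -sumrN; apply: eq_bigr => x _; rewrite mulrN.
    by rewrite lerN2.
Qed.

Lemma matched_pairs_gt0 : (0 < #|matched_pairs G|)%N.
Proof.
apply/card_gt0P; exists (set0, set0); rewrite inE !sub0set /=.
by apply/existsP; exists set0; apply: perfect_matching0.
Qed.

(* The union of a matched pair determines it, since its two parts lie on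
   opposite sides. *)
Lemma card_matched_pairs_le : (#|matched_pairs G| <= 2 ^ #|vertex G|)%N.
Proof.
rewrite -cardsT -card_powerset powersetT.
pose f (S : {set vertex G} * {set vertex G}) := S.1 :|: S.2.
rewrite -(card_in_imset (f := f)) ?subset_leq_card ?subsetT //.
have f_top S : S \in matched_pairs G -> f S :&: top G = S.1 /\ f S :\: top G = S.2.
  rewrite inE => /and3P[St Sb _]; split; apply/setP => x; rewrite !inE.
    have [x1|x1] := boolP (x \in S.1); first by rewrite (subsetP St).
    have [x2|//] := boolP (x \in S.2).
    by have := subsetP Sb _ x2; rewrite inE => /negPf.
  have [x2|x2] := boolP (x \in S.2).
    by have := subsetP Sb _ x2; rewrite inE orbT andbT.
  rewrite orbF; have [x1|_] := boolP (x \in S.1); last by rewrite andbF.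
  by rewrite (subsetP St).
move=> S T /f_top[S1 S2] /f_top[T1 T2] fE.
by apply: injective_projections; rewrite -?S1 -?S2 -?T1 -?T2 fE.
Qed.

(** The only matched pair is then the empty one, of discrepancy 0. This settles the case where the
    logarithm, and so the sample budget, vanishes. *)
Lemma matched_pairs_le1_not_far (eps : R) (p : {ffun vertex G -> R}) :
    0 < eps -> (#|matched_pairs G| <= 1)%N -> distribution p ->
  ~ far_from_monotone eps p.
Proof.
move=> eps0 /card_le1_eqP M1 pd /(far_disc _ _ _ _ pd)[S SM].
have -> : S = (set0, set0).
  apply: M1 => //; rewrite inE !sub0set /=.
  by apply/existsP; exists set0; apply: perfect_matching0.
by rewrite discE /= !big_set0; lra.
Qed.

End Tester.

(** * Choice of the sample size and constants *)

Lemma ln2_ge (R : realType) : 2^-1 <= ln 2 :> R.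
Proof.
rewrite -[leLHS]expRK ler_ln ?posrE ?expR_gt0 //.
rewrite -[2^-1]opprK expRN -[leRHS]invrK lef_pV2 ?posrE ?expR_gt0 ?invr_gt0 //.
by apply: le_trans (expR_ge1Dx _); lra.
Qed.

Lemma testable_ln_matched_pairs (R : realType) (G : bipartite_poset) (eps : R) :
    0 < eps ->
  exists2 m : nat, m%:R <= 386 * (ln (#|matched_pairs G|%:R : R) / eps ^+ 2)
    & testable_with G eps m.
Proof.
move=> eps0; set M := #|matched_pairs G|.
have M0 : (0 < M)%N := matched_pairs_gt0 G.
have lnM0 : 0 <= ln (M%:R : R) by rewrite ln_ge0 // -[1]/(1%:R) ler_nat.
have bound0 : 0 <= 386 * (ln (M%:R : R) / eps ^+ 2).
  by rewrite mulr_ge0 ?divr_ge0 ?sqr_ge0.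
have [eps1|eps1] := ltP 1 eps.
  (* No distribution is [eps]-far when [eps] exceeds 1, so always accepting works. *)
  exists 0%N => //; apply: testable_with0 => p pd /(far_le1 _ _ _ _ pd).
  by rewrite leNgt eps1.
have [M1|M2] := leqP M 1.
  by exists 0%N => //; apply: testable_with0 => p; apply: matched_pairs_le1_not_far.
have MR0 : 0 < M%:R :> R by rewrite ltr0n.
have lnM : 2^-1 <= ln (M%:R : R).
  apply: le_trans (ln2_ge R) _; rewrite ler_ln ?posrE ?ltr0n //.
  by rewrite ler_nat.
pose L : R := ln M%:R / eps ^+ 2.
have eps2 : 0 < eps ^+ 2 by rewrite exprn_gt0.
have L2 : 2^-1 <= L.
  rewrite /L ler_pdivlMr //; apply: le_trans lnM.
  by rewrite -[leRHS]mulr1 ler_wpM2l ?invr_ge0 // expr_le1 // ltW.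
(* Since 384 is 3 times 128, the union bound gives at most M times M to the power -3, which is at
   most 1/4 for M at least 2. Rounding up costs at most 1, absorbed in [2 * L] because [L] is at
   least 1/2; hence 386. *)
exists (Num.truncn (384 * L)).+1.
  rewrite -natr1; have : (Num.truncn (384 * L))%:R <= 384 * L.
    by rewrite truncn_le //; move: L2; lra.
  by rewrite -/L; move: L2; lra.
apply: testable_with_large_sample => //; first by rewrite eps0.
set m := _.+1.
have mL : 3 * ln M%:R <= m%:R * eps ^+ 2 / 128.
  have : 384 * L <= m%:R by rewrite ltW // truncnS_gt.
  rewrite -(ler_pM2r eps2); have -> : 384 * L * eps ^+ 2 = 384 * ln M%:R.
    by rewrite -mulrA divfK // gt_eqF.
  lra.
rewrite -/M; apply: le_trans (_ : M%:R * (M%:R ^- 3) <= _).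
  rewrite ler_wpM2l ?ler0n // -[M%:R in leRHS](lnK) ?posrE //.
  by rewrite -expRM_natl -expRN ler_expR lerN2.
rewrite exprS invfM mulrA divff ?gt_eqF // mul1r lef_pV2 ?posrE ?exprn_gt0 //.
rewrite -natrX ler_nat; apply: leq_trans (_ : 2 ^ 2 <= _)%N => //.
by rewrite leq_exp2r.
Qed.

Theorem theorem11 (R : realType) :
  (exists2 C : R, 0 < C &
     forall (G : bipartite_poset) (eps : R), 0 < eps ->
       exists2 m : nat,
         m%:R <= C * (ln (#|matched_pairs G|%:R : R) / eps ^+ 2)
         & testable_with G eps m) /\
  (exists2 C : R, 0 < C &
     forall (G : bipartite_poset) (eps : R), 0 < eps ->
       exists2 m : nat,
         m%:R <= C * (#|vertex G|%:R / eps ^+ 2)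
         & testable_with G eps m).
Proof.
split; exists 386 => // G eps eps0; first exact: testable_ln_matched_pairs.
have [m mle tm] := testable_ln_matched_pairs R G eps eps0; exists m => //.
apply: le_trans mle _; rewrite ler_pM2l // ler_pM2r ?invr_gt0 ?exprn_gt0 //.
apply: le_trans (_ : ln (2 ^+ #|vertex G|) <= _).
  rewrite ler_ln ?posrE ?exprn_gt0 ?ltr0n ?matched_pairs_gt0 //.
  by rewrite -natrX ler_nat card_matched_pairs_le.
rewrite lnXn // -[ln 2 *+ _]mulr_natl -[leRHS]mulr1 ler_wpM2l ?ler0n //.
(* [ln 2 <= 1] is the case [x = 1] of [ln (1 + x) <= x], so the constant 386 carries over. *)
by have := @le_ln1Dx R 1; apply; lra.
Qed.
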